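(* Let $f: G \rightarrow H$ be a surjective group homomorphism and let $\mu \in L(H)$. Let $\eta \in L(\mu)$ and let $a_z \in \mu$ be an $L$-point of $\mu$ (with $a\in L$, $z\in H$). Then the $L$-subgroup $f^{-1}(\eta^{a_z})$ is a conjugate $L$-subgroup of $f^{-1}(\eta)$ in $f^{-1}(\mu)$, i.e. it equals $f^{-1}(\eta)^{b_w}$ for some $L$-point $b_w$ of $f^{-1}(\mu)$. In fact, for $s \in f^{-1}(z)$, $a_s$ serves as such an $L$-point: \[ f^{-1}(\eta^{a_z}) = f^{-1}(\eta)^{a_s}. \]
   Context: $L=\langle L,\le,\vee,\wedge\rangle$ is a completely distributive (complete) lattice with greatest element $1$ and least element $0$. An $L$-subset of a set $X$ is a function $X\to L$; $\eta\subseteq\mu$ means $\eta(x)\le\mu(x)$ for all $x$. For a group $G$, an $L$-subset $\mu$ of $G$ is an $L$-subgroup of $G$ if $\mu(xy)\ge\mu(x)\wedge\mu(y)$ and $\mu(x^{-1})=\mu(x)$ for all $x,y\in G$; $L(G)$ is the set of $L$-subgroups of $G$. For $\mu\in L(G)$, $L(\mu)$ denotes the set of $\eta\in L(G)$ with $\eta\subseteq\mu$ (the $L$-subgroups of $\mu$). For $a\in L$ and $z\in G$, the $L$-point $a_z$ is the $L$-subset with value $a$ at $z$ and $0$ elsewhere; it is an $L$-point of $\mu$ (written $a_z\in\mu$) if $\mu(z)\ge a$. For $\eta\in L(\mu)$ and $a_z\in\mu$, the conjugate of $\eta$ by $a_z$ is the $L$-subgroup $\eta^{a_z}$ of $\mu$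 given by $\eta^{a_z}(x)=a\wedge\eta(zxz^{-1})$ for all $x$ (the same definitions apply to the group $H$). For a map $f:G\to H$ and an $L$-subset $\nu$ of $H$, the preimage $f^{-1}(\nu)$ is the $L$-subset of $G$ given by $f^{-1}(\nu)(x)=\nu(f(x))$. The preimage of an $L$-subgroup under a group homomorphism is an $L$-subgroup. *)

(* Defs.v *)
From mathcomp Require Import all_boot all_order.
From mathcomp Require Import boolp classical_sets.
Set Implicit Arguments.
Unset Strict Implicit.
Unset Printing Implicit Defensive.

Local Open Scope group_scope.
Local Open Scope order_scope.

Section CompleteLattice.
Context {disp : Order.disp_t} (L : tbLatticeType disp).

Definition complete_lattice : Prop :=
  forall A : set L, (exists s, supremums A s) /\ (exists i, infimums A i).

(* [supremum x0 A] is [x0] when [A] is empty (or has no supremum), so the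
   default values must be \bot for joins and \top for meets. *)
Definition bigjoin (I : Type) (x : I -> L) : L := supremum \bot (range x).
Definition bigmeet (I : Type) (x : I -> L) : L := infimum \top (range x).

Definition completely_distributive : Prop :=
  complete_lattice /\
  forall (I : Type) (J : I -> Type) (x : forall i, J i -> L),
    bigmeet (fun i => bigjoin (fun j => x i j)) =
    bigjoin (fun c : forall i, J i => bigmeet (fun i => x i (c i))).

End CompleteLattice.

Section LSubgroups.
Context {disp : Order.disp_t} {L : tbLatticeType disp} {G : groupType}.
Implicit Types (mu eta theta : G -> L) (a : L) (z : G).

Definition Lsubset eta mu : Prop := forall x, eta x <= mu x.

Definition Lsubgroup mu : Prop :=
  (forall x y, mu x `&` mu y <= mu (x * y)) /\ (forall x, mu x^-1 = mu x).

Definition Lsubgroup_of mu eta : Prop := Lsubgroup eta /\ Lsubset eta mu.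

Definition Lpoint a z : G -> L := fun x => if x == z then a else \bot.

Definition Lpoint_of mu a z : Prop := a <= mu z.

Lemma Lpoint_ofP mu a z : Lpoint_of mu a z <-> Lsubset (Lpoint a z) mu.
Proof.
split=> [le_a x|/(_ z)]; last by rewrite /Lpoint eqxx.
by rewrite /Lpoint; case: eqP => [->|_]; rewrite ?le0x.
Qed.

(* The L-point [a_z] is passed as the pair [a], [z]: as an L-subset it does not
   determine [z] when [a] is \bot. *)
Definition Lconj eta a z : G -> L := fun x => a `&` eta (z * x * z^-1).

Definition Lconjugate_in mu eta theta : Prop :=
  [/\ Lsubgroup mu, Lsubgroup_of mu eta, Lsubgroup_of mu theta &
      exists b w, Lpoint_of mu b w /\ theta = Lconj eta b w].

End LSubgroups.

Definition Lpreim (G H T : Type) (f : G -> H) (nu : H -> T) : G -> T :=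
  fun x => nu (f x).

(* Main.v *)
Require Import Defs.
From mathcomp Require Import all_boot all_order.
From mathcomp Require Import boolp.
Import Order.LTheory.

Local Open Scope group_scope.
Local Open Scope order_scope.

(** Choose [s] with [f s = z]; surjectivity of [f] supplies one. Since
    [f (s * x * s^-1) = z * f x * z^-1], both L-subsets take the value of the meet of [a] and
    [eta (z * f x * z^-1)] at every [x]; this is [Lpreim_conj]. That [L]-subgroups and containment
    are respected comes from closure under preimages ([Lsubgroup_preim]) and under conjugation
    ([Lsubgroup_conj]), and from the fact that conjugating by a point of [mu] does not lead out of
    [mu] ([Lsubset_conj]). *)

(* [gmulfV] requires a unital morphism; between groups multiplicativity
   suffices. *)
Lemma multiplicativeV (G H : groupType) (f : {multiplicative G -> H}) :
  {morph f : x / x^-1}.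
Proof.
have f1 : f 1 = 1 by apply: (mulgI (f 1)); rewrite -gmulfM !mulg1.
by move=> x; apply: (mulgI (f x)); rewrite -gmulfM !mulgV.
Qed.

Lemma Lsubgroup_preim (disp : Order.disp_t) (L : tbLatticeType disp)
    (G H : groupType) (f : {multiplicative G -> H}) (nu : H -> L) :
  Lsubgroup nu -> Lsubgroup (Lpreim f nu).
Proof.
case=> nuM nuV; split=> [x y|x]; rewrite /Lpreim.
  by rewrite gmulfM.
by rewrite multiplicativeV.
Qed.

(** Conjugation by [z] is an automorphism of the group, and cutting values down by the constant [a]
    is harmless because meet is idempotent. *)
Lemma Lsubgroup_conj (disp : Order.disp_t) (L : tbLatticeType disp)
    (G : groupType) (eta : G -> L) (a : L) (z : G) :
  Lsubgroup eta -> Lsubgroup (Lconj eta a z).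
Proof.
case=> etaM etaV; split=> [x y|x]; rewrite /Lconj.
  have -> : z * (x * y) * z^-1 = (z * x * z^-1) * (z * y * z^-1).
    by rewrite !mulgA mulgVK.
  by rewrite meetACA meetxx leI2.
by rewrite -[in RHS]etaV !invgM invgK !mulgA.
Qed.

(** Undo the conjugation: [x] is the product of [z^-1], [z * x * z^-1] and [z]. On the outer factors
    [mu] is at least [a], on the middle one at least [eta]. *)
Lemma Lsubset_conj (disp : Order.disp_t) (L : tbLatticeType disp)
    (G : groupType) (mu eta : G -> L) (a : L) (z : G) :
  Lsubgroup mu -> Lsubset eta mu -> Lpoint_of mu a z ->
  Lsubset (Lconj eta a z) mu.
Proof.
move=> [muM muV] eta_mu a_mu x; rewrite /Lconj.
have -> : mu x = mu (z^-1 * ((z * x * z^-1) * z)).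
  by rewrite mulgVK mulKg.
apply: le_trans (muM _ _); rewrite muV lexI.
rewrite leIxl //=; apply: le_trans (muM _ _).
by rewrite meetC leI2.
Qed.

Lemma Lpreim_conj (disp : Order.disp_t) (L : tbLatticeType disp)
    (G H : groupType) (f : {multiplicative G -> H}) (eta : H -> L)
    (a : L) (s : G) :
  Lpreim f (Lconj eta a (f s)) = Lconj (Lpreim f eta) a s.
Proof. by apply: funext => x; rewrite /Lpreim /Lconj !gmulfM multiplicativeV. Qed.

Theorem theorem3p5 (disp : Order.disp_t) (L : tbLatticeType disp)
    (hL : completely_distributive L)
    (G H : groupType) (f : {multiplicative G -> H})
    (f_surj : forall y : H, exists x : G, f x = y)
    (mu : H -> L) (hmu : Lsubgroup mu)
    (eta : H -> L) (heta : Lsubgroup_of mu eta)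
    (a : L) (z : H) (haz : Lpoint_of mu a z) :
  Lconjugate_in (Lpreim f mu) (Lpreim f eta) (Lpreim f (Lconj eta a z)) /\
  (forall s : G, f s = z ->
     Lpoint_of (Lpreim f mu) a s /\
     Lpreim f (Lconj eta a z) = Lconj (Lpreim f eta) a s).
Proof.
have [eta_grp eta_mu] := heta.
have fiber s : f s = z -> Lpoint_of (Lpreim f mu) a s /\
    Lpreim f (Lconj eta a z) = Lconj (Lpreim f eta) a s.
  (* Once [z] is replaced by [f s], the point condition is [haz] up to unfolding [Lpreim]. *)
  by move=> fs; subst z; split; last exact: Lpreim_conj.
split=> //; split.
- exact: Lsubgroup_preim.
- by split=> [|x]; [exact: Lsubgroup_preim | exact: eta_mu].
- split=> [|x]; last exact: Lsubset_conj.
  exact/Lsubgroup_preim/Lsubgroup_conj.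
- by have [s /fiber ?] := f_surj z; exists a, s.
Qed.
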